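(* Let $C\subset N$ and let $\beta$ be an integer with $1<\beta<|C|$. If the inequality $\sum_{j\in C}x_j\leq\beta$ is valid for the quadratic knapsack problem, i.e. it holds for every $x\in\{0,1\}^n$ with $w^Tx\leq c$, then the inequality $$\sum_{i,j\in C,\ i<j}X_{ij}\leq\binom{\beta}{2}$$ is valid for the lifted problem, i.e. it holds for every $(x,X)$ with $x\in\{0,1\}^n$, $w^Tx\leq c$ and $X=xx^T$.
   Context: Let $N=\{1,\ldots,n\}$, let $w\in\mathbb{Z}^n$ have positive entries, and let $c$ be a positive integer with $c\geq w_i$ for all $i\in N$. The quadratic knapsack problem has feasible set $\{x\in\{0,1\}^n : w^Tx\leq c\}$, and its lifted version has feasible set $\{(x,X)\in\{0,1\}^n\times\mathbb{S}^n : w^Tx\leq c,\ X=xx^T\}$, where $\mathbb{S}^n$ is the set of real symmetric $n\times n$ matrices. The displayed inequality in $X$ is called the cover inequality in the lifted space (CILS) derived from $\sum_{j\in C}x_j\leq\beta$. *)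

(* Defs.v *)
From HB Require Import structures.
From mathcomp Require Import all_boot all_order all_algebra reals.
Set Implicit Arguments.
Unset Strict Implicit.
Unset Printing Implicit Defensive.
Import Order.TTheory GRing.Theory Num.Theory.
Local Open Scope ring_scope.

Definition binary (R : realType) (n : nat) (x : 'cV[R]_n) : Prop :=
  forall i : 'I_n, x i 0 = 0 \/ x i 0 = 1.

Definition qkp_feasible (R : realType) (n : nat) (w : 'cV[int]_n) (c : int)
    (x : 'cV[R]_n) : Prop :=
  binary x /\ ((map_mx intr w)^T *m x) 0 0 <= c%:~R.

(* The first conjunct places X in the space of symmetric matrices. *)
Definition lifted_qkp_feasible (R : realType) (n : nat) (w : 'cV[int]_n)
    (c : int) (x : 'cV[R]_n) (X : 'M[R]_n) : Prop :=
  [/\ X^T = X, qkp_feasible w c x & X = x *m x^T].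

(* Main.v *)
Require Import Defs.
From HB Require Import structures.
From mathcomp Require Import all_boot all_order all_algebra reals.
Set Implicit Arguments.
Unset Strict Implicit.
Unset Printing Implicit Defensive.
Import Order.TTheory GRing.Theory Num.Theory.
Local Open Scope ring_scope.

(** A feasible [x] takes the value 1 on exactly [k] elements of [C], for some
    [k], and is 0 on the rest of [C]. Since [X i j = x i * x j], the left-hand
    side counts the pairs of chosen elements of [C], so it equals ['C(k, 2)].
    The cover inequality says [k <= beta], and ['C(k, 2)] is nondecreasing
    in [k].

    The count ([sum_ltn_mul_bin2]) is read off from the expansion of the square
    of a sum ([sqr_sum_ltn]), which avoids enumerating pairs. *)

Lemma sqr_sum_ltn (S : comPzSemiRingType) (n : nat) (C : {set 'I_n})
    (y : 'I_n -> S) :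
  (\sum_(i in C) y i) ^+ 2 =
  \sum_(i in C) y i ^+ 2
  + (\sum_(i in C) \sum_(j in C | (i < j)%N) y i * y j) *+ 2.
Proof.
have lowE : \sum_(i in C) \sum_(j in C | (j < i)%N) y i * y j =
            \sum_(i in C) \sum_(j in C | (i < j)%N) y i * y j.
  rewrite (exchange_big_dep (mem C)) /=; last by move=> i j _ /andP[].
  apply: eq_bigr => i iC; apply: eq_big => [j|j _]; last exact: mulrC.
  by rewrite iC.
rewrite mulr2n -{1}lowE -!big_split /= expr2 mulr_suml.
apply: eq_bigr => i iC; rewrite mulr_sumr (bigD1 i) //= -expr2; congr (_ + _).
rewrite (bigID (fun j : 'I_n => (j < i)%N)) /=.
congr (_ + _); apply: eq_bigl => j; rewrite -andbA; congr (_ && _).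
  by rewrite -val_eqE /=; case: ltngtP.
by rewrite -val_eqE /=; case: ltngtP.
Qed.

Lemma sum_binary_card (R : realType) (n : nat) (C : {set 'I_n})
    (x : 'cV[R]_n) :
  binary x -> \sum_(i in C) x i 0 = #|[set i in C | x i 0 == 1]|%:R.
Proof.
move=> xbin; rewrite -sum1_card natr_sum.
rewrite (big_setID [set i | x i 0 == 1]) /= [X in _ + X]big1 ?addr0.
  by apply: eq_big => [i|i]; rewrite !inE // => /andP[_ /eqP].
by move=> i; rewrite !inE => /andP[/eqP xi1 _]; case: (xbin i).
Qed.

(** The entries of [x] are idempotent, so the diagonal of the squared sum is the
    sum itself; what remains off the diagonal is [k ^ 2 - k = k (k - 1)], that
    is, [2 'C(k, 2)], and 2 cancels in [R]. *)
Lemma sum_ltn_mul_bin2 (R : realType) (n : nat) (C : {set 'I_n})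
    (x : 'cV[R]_n) :
  binary x ->
  \sum_(i in C) \sum_(j in C | (i < j)%N) x i 0 * x j 0 =
  'C(#|[set i in C | x i 0 == 1]|, 2)%:R.
Proof.
move=> xbin; have := sqr_sum_ltn C (fun i => x i 0).
have -> : \sum_(i in C) x i 0 ^+ 2 = \sum_(i in C) x i 0.
  by apply: eq_bigr => i _; case: (xbin i) => ->; rewrite ?expr0n ?expr1n.
rewrite sum_binary_card //; set k := #|_| => sqr_k.
apply/eqP; rewrite -(eqr_pMn2r (n := 2)) //; apply/eqP/(addrI k%:R).
rewrite -sqr_k -natrX -mulrnA -natrD; congr _%:R.
rewrite mulnC mul_bin_left bin1 mulnC.
by case: k {sqr_k} => // k; rewrite subn1 -mulnS.
Qed.

Theorem theorem11 (R : realType) (n : nat) (w : 'cV[int]_n) (c : int)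
    (w_gt0 : forall i : 'I_n, 0 < w i 0)
    (c_gt0 : 0 < c)
    (w_le_c : forall i : 'I_n, w i 0 <= c)
    (C : {set 'I_n}) (beta : nat)
    (beta_bounds : (1 < beta < #|C|)%N)
    (valid_ineq : forall x : 'cV[R]_n, qkp_feasible w c x ->
       \sum_(j in C) x j 0 <= beta%:R) :
  forall (x : 'cV[R]_n) (X : 'M[R]_n), lifted_qkp_feasible w c x X ->
    \sum_(i in C) \sum_(j in C | (i < j)%N) X i j <= 'C(beta, 2)%:R.
Proof.
move=> x X [_ xfeas ->]; have [xbin _] := xfeas.
under eq_bigr => i _ do under eq_bigr => j _ do
  rewrite mxE big_ord1 [x^T _ _]mxE.
rewrite sum_ltn_mul_bin2 // ler_nat; apply: leq_bin2l.
by have := valid_ineq x xfeas; rewrite sum_binary_card // ler_nat.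
Qed.
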